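(* Let $G$ be a torsion-free, class-$2$ nilpotent group. Then $G$ has the Magnus property.
   Context: A group $G$ has the Magnus property if, whenever $g,h \in G$ generate the same normal subgroup $\langle g\rangle^G = \langle h\rangle^G$ (normal closures), $g$ is conjugate in $G$ to $h$ or to $h^{-1}$. *)

(* Defs.v *)
From mathcomp Require Import all_boot.
From mathcomp Require Import boolp classical_sets.

Set Implicit Arguments.
Unset Strict Implicit.
Unset Printing Implicit Defensive.

Local Open Scope classical_set_scope.
Local Open Scope group_scope.

(* [groupType] is not restricted to finite groups.  Subgroups are Prop-valued
   subsets, since membership in a subgroup need not be decidable. *)

Definition is_subgroup (G : groupType) (H : set G) : Prop :=
  H 1 /\ forall x y : G, H x -> H y -> H (x / y).

Definition is_normal_subgroup (G : groupType) (N : set G) : Prop :=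
  is_subgroup N /\ forall x y : G, N x -> N (x ^ y).

Definition normal_closure (G : groupType) (g : G) : set G :=
  smallest (@is_normal_subgroup G) [set g].

Definition conjugate (G : groupType) (g h : G) : Prop :=
  exists x : G, g ^ x = h.

Definition magnus_property (G : groupType) : Prop :=
  forall g h : G, normal_closure g = normal_closure h ->
    conjugate g h \/ conjugate g h^-1.

Definition torsion_free (G : groupType) : Prop :=
  forall (x : G) (n : nat), 0 < n -> x ^+ n = 1 -> x = 1.

Definition commutator_subgroup (G : groupType) (A B : set G) : set G :=
  smallest (@is_subgroup G) [set [~ a, b] | a in A & b in B].

(* Indexed from 0: [lower_central G n] is the term usually written
   gamma_(n+1)(G), so that it is trivial iff G is nilpotent of class <= n. *)
Fixpoint lower_central (G : groupType) (n : nat) {struct n} : set G :=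
  if n is m.+1 then commutator_subgroup (lower_central m) setT else setT.
Arguments lower_central G n : clear implicits.

(* The class is exactly c: c is least such that the series is trivial. *)
Definition nilpotent_of_class (G : groupType) (c : nat) : Prop :=
  lower_central G c = [set 1] /\
  forall d : nat, d < c -> lower_central G d <> [set 1].

(* Main.v *)
Require Import Defs.
From mathcomp Require Import all_boot.
From mathcomp Require Import classical_sets.

(** In class 2 every commutator is central, so the commutator is a morphism in
each argument, and every element of the normal closure of [g] is of the
form [g ^ k * [~ g, u]] with [k] an integer ([mem_normal_closure]).

Suppose that [g] and [h] have the same normal closure.  Up to replacing [h] by
its inverse, [h = g ^ k * [~ g, x]] with [k] a natural number, and [g] or its
inverse is [h ^ l * [~ h, y]] with [l] a natural number.  Substituting the
first equation in the second gives [g ^ e = g ^ (k * l) * [~ g, w]] with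
[e = 1] or [e = -1].  Either [e = k * l], in which case [k = 1] and
[h = g * [~ g, x] = g ^ x], or a positive power of [g] is a commutator
[[~ g, w']].  In the latter case this power is central, hence so is [g],
because [[~ g, u] ^ n = [~ g ^ n, u] = 1] forces [[~ g, u] = 1] in the absence
of torsion.  The commutator [[~ g, w']] is then trivial, and again by absence
of torsion [g = 1], so that [h = 1] too ([expg_eq_commg]). *)

Set Implicit Arguments.
Unset Strict Implicit.
Unset Printing Implicit Defensive.

Local Open Scope group_scope.

Definition central_commutators (G : groupType) : Prop :=
  forall x y z : G, commute [~ x, y] z.

Lemma class2_central_commutators (G : groupType) :
  nilpotent_of_class G 2 -> central_commutators G.
Proof.
move=> [G3_triv _] x y z; apply/commgP/eqP.
suff: lower_central G 2 [~ [~ x, y], z] by rewrite G3_triv.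
apply: sub_gen_smallest; exists [~ x, y]; last by exists z.
by apply: sub_gen_smallest; exists x => //; exists y.
Qed.

Lemma commMg_central (G : groupType) (x y z : G) :
  central_commutators G -> [~ x * y, z] = [~ x, z] * [~ y, z].
Proof.
move=> cen; rewrite [LHS]commgEl conjMg invgM -mulgA (mulgA x^-1) -commgEl.
by rewrite mulgA -(cen x z y^-1) -mulgA.
Qed.

Lemma commgM_central (G : groupType) (x y z : G) :
  central_commutators G -> [~ x, y * z] = [~ x, y] * [~ x, z].
Proof.
move=> cen; rewrite -invgR commMg_central // invgM !invgR; exact: cen.
Qed.

Lemma commVg_central (G : groupType) (x y : G) :
  central_commutators G -> [~ x^-1, y] = [~ x, y]^-1.
Proof.
move=> cen; apply/esym/mulg1_eq.
by rewrite -commMg_central // mulgV comm1g.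
Qed.

Lemma commgV_central (G : groupType) (x y : G) :
  central_commutators G -> [~ x, y^-1] = [~ x, y]^-1.
Proof. by move=> cen; rewrite -[LHS]invgR commVg_central // invgR. Qed.

Lemma commXg_central (G : groupType) (x y : G) n :
  central_commutators G -> [~ x ^+ n, y] = [~ x, y] ^+ n.
Proof.
by move=> cen; elim: n => [|n IHn]; rewrite ?comm1g // !expgS commMg_central ?IHn.
Qed.

Lemma commgX_central (G : groupType) (x y : G) n :
  central_commutators G -> [~ x, y ^+ n] = [~ x, y] ^+ n.
Proof.
by move=> cen; elim: n => [|n IHn]; rewrite ?commg1 // !expgS commgM_central ?IHn.
Qed.

(** If a positive power of [g] is a commutator, hence central, then [g] itself
is central: all the commutators [[~ g, u]] are torsion elements.  The power is
then trivial when the commutator involves [g]. *)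
Lemma expg_eq_commg (G : groupType) (g w : G) n :
  torsion_free G -> central_commutators G ->
  0 < n -> g ^+ n = [~ g, w] -> g = 1.
Proof.
move=> tf cen n_gt0 gnE.
suff gw1 : [~ g, w] = 1 by apply: tf n_gt0 _; rewrite gnE.
apply: tf n_gt0 _; rewrite -commXg_central // gnE; apply/eqP/commgP; exact: cen.
Qed.

(** The integer exponent is a difference [a - b] of natural numbers, which
makes the set visibly closed under division. *)
Definition powers_times_commutators (G : groupType) (g : G) : set G :=
  fun x => exists a b u, x = g ^+ a / g ^+ b * [~ g, u].

Lemma powers_times_commutators_normal (G : groupType) (g : G) :
  central_commutators G -> is_normal_subgroup (powers_times_commutators g).
Proof.
move=> cen; split; first split.
- by exists 0, 0, 1; rewrite commg1 !gsimp.
- move=> _ _ [a [b [u ->]]] [c [d [v ->]]]; exists (a + d), (c + b), (u / v).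
  have cUV z : commute ([~ g, u] / [~ g, v]) z.
    apply/commute_sym/commuteM; [|apply: commuteV]; apply/commute_sym; exact: cen.
  rewrite commgM_central // commgV_central // !expgnDr.
  move: [~ g, u] [~ g, v] cUV => U V cUV; rewrite !invgM !invgK.
  have cbd : commute (g ^+ d) (g ^- b) by apply/commuteV/commuteX2.
  rewrite -(mulgA (g ^+ a) (g ^+ d)) (mulgA (g ^+ d)) cbd.
  by rewrite -(mulgA (g ^+ a / _)) (mulgA U) cUV !mulgA.
- move=> _ y [a [b [u ->]]]; exists a, b, (u * (y ^+ a / y ^+ b)).
  set x := (X in X ^ y); rewrite -[LHS](mulVKg x) -commgEl.
  (* Conjugation by y multiplies by [~ x, y] = [~ g, y] ^ (a - b), which is
     again of the form [~ g, _]. *)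
  have -> : [~ x, y] = [~ g, y ^+ a / y ^+ b].
    rewrite /x 2?commMg_central // commVg_central // !commXg_central //.
    rewrite commgM_central // commgV_central // !commgX_central //.
    have /commgP/eqP -> : commute [~ g, u] y by exact: cen.
    by rewrite mulg1.
  by rewrite /x -mulgA -commgM_central.
Qed.

Lemma mem_normal_closure (G : groupType) (g x : G) :
  central_commutators G -> normal_closure g x ->
  exists k u, x = g ^+ k * [~ g, u] \/ x^-1 = g ^+ k * [~ g, u].
Proof.
move=> cen gx; have: powers_times_commutators g x.
  apply: smallest_sub gx; first exact: powers_times_commutators_normal.
  by move=> _ ->; exists 1%N, 0, 1; rewrite commg1 !gsimp.
move=> [a [b [u ->]]]; case: (leqP b a) => [le_ba | /ltnW le_ab].
  by exists (a - b), u; left; rewrite expgnFr.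
exists (b - a), u^-1; right.
rewrite commgV_central // expgnFr //.
move: [~ g, u] (cen g u) => c cC; rewrite !invgM invgK.
exact/commute_sym/commuteV/commute_sym/cC.
Qed.

Lemma normal_closure_self (G : groupType) (g : G) : normal_closure g g.
Proof. exact: sub_gen_smallest. Qed.

Lemma normal_closureV (G : groupType) (g x : G) :
  normal_closure g x -> normal_closure g^-1 x.
Proof.
move=> gx N [nN gVN]; apply: gx; split=> // _ ->.
have [[N1 Ndiv] _] := nN.
by rewrite -[g]invgK -[g^-1^-1]mul1g; apply: Ndiv => //; apply: gVN.
Qed.

(** Writing [h] for the element generating the second normal closure, expressing
[g] through [h] and then [h] through [g] gives the relation
[g = g ^ (k * l) * [~ g, w]], up to inverting the left-hand side.  It forces
[k = 1], where [g * [~ g, x]] is by definition [g ^ x], or [g = 1]. *)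
Lemma conjugate_of_mutual_membership (G : groupType) (g x : G) k :
  torsion_free G -> central_commutators G ->
  normal_closure (g ^+ k * [~ g, x]) g -> conjugate g (g ^+ k * [~ g, x]).
Proof.
move=> tf cen /(mem_normal_closure cen)[l [y]].
have -> : (g ^+ k * [~ g, x]) ^+ l * [~ g ^+ k * [~ g, x], y]
          = g ^+ (k * l)%N * [~ g, x ^+ l * y ^+ k].
  (* The factor [~ g, x] is central: it commutes with g ^+ k, and it vanishes
     in the commutator with y. *)
  rewrite expgMn; last by apply/commute_sym; exact: cen.
  rewrite -expgnA commMg_central // commXg_central //.
  have /commgP/eqP -> : commute [~ g, x] y by exact: cen.
  by rewrite mulg1 commgM_central // !commgX_central // mulgA.
set w := x ^+ l * y ^+ k => gE.
have conj_of_g1 : g = 1 -> conjugate g (g ^+ k * [~ g, x]).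
  by move=> ->; exists 1; rewrite comm1g expg1n mulg1 conj1g.
case: gE => [gE | gVE].
- have [/eqP|kl_neq1] := eqVneq (k * l)%N 1%N.
    rewrite muln_eq1 => /andP[/eqP-> _].
    by exists x; rewrite expg1 commgEl mulVKg.
  apply: conj_of_g1; case: (k * l)%N kl_neq1 gE => [_|[//|m] _] gE.
    by apply: (@expg_eq_commg _ _ w 1%N) => //; rewrite {1}gE mul1g.
  apply: (@expg_eq_commg _ _ w^-1 m.+1) => //.
  rewrite commgV_central //; apply/eqP; rewrite -mulg_eq1; apply/eqP.
  by apply: (@mulgI _ g); rewrite mulg1 mulgA -expgS -gE.
- apply: conj_of_g1; apply: (@expg_eq_commg _ _ w^-1 (k * l)%N.+1) => //.
  rewrite commgV_central //; apply/eqP; rewrite -mulg_eq1; apply/eqP.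
  by rewrite expgS -mulgA -gVE mulgV.
Qed.

Theorem proposition3p2 (G : groupType) :
  torsion_free G -> nilpotent_of_class G 2 -> magnus_property G.
Proof.
move=> tf /class2_central_commutators cen g h ngh.
have gh : normal_closure g h by rewrite ngh; apply: normal_closure_self.
have hg : normal_closure h g by rewrite -ngh; apply: normal_closure_self.
have [k [x [hE | hVE]]] := mem_normal_closure cen gh; [left | right].
  by rewrite hE in hg *; apply: conjugate_of_mutual_membership.
move/normal_closureV: hg; rewrite hVE.
exact: conjugate_of_mutual_membership.
Qed.
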